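(* Consider a Bayesian inverse problem with prior $\mu_{\mathrm{prior}}$ and likelihood $L$. Suppose that the following hold for $\mu_{\mathrm{prior}}$-almost every $\theta'\in X$ and every $y^\dagger\in Y$: (A1) $L(\cdot|\theta')$ is a strictly positive probability density function (with respect to $\nu_Y$); (A2) $L(y^\dagger|\cdot)\in \mathbf{L}^1(X,\mu_{\mathrm{prior}})$; (A3) there exists $g\in\mathbf{L}^1(X,\mu_{\mathrm{prior}})$ such that $L(y^\ddagger|\cdot)\le g$ for all $y^\ddagger\in Y$; (A4) $L(\cdot|\theta')$ is continuous on $Y$; (A6) there are a $\delta>0$ and a function $h(\cdot,y^\dagger)\in\mathbf{L}^1(X,\mu_{\mathrm{post}}^\dagger)$ such that $|\log L(y^\ddagger|\cdot)|\le h(\cdot,y^\dagger)$ for all $y^\ddagger\in Y$ with $\|y^\dagger-y^\ddagger\|_Y\le\delta$. Then the Bayesian inverse problem is Kullback--Leibler well-posed.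
   Context: Setting. $(Y,\|\cdot\|_Y)$ is a separable Banach space (data space). The parameter space $X$ is a measurable subset of a separable, completely metrisable topological vector space $(X',\mathcal{T}')$. $X$ and $Y$ carry their Borel $\sigma$-algebras $\mathcal{B}X$, $\mathcal{B}Y$. $\mathrm{Prob}(X)$ is the set of probability measures on $(X,\mathcal{B}X)$, and $\mathrm{Prob}(X,\mu)$ is the set of those that are absolutely continuous with respect to $\mu$. $\nu_X$ and $\nu_Y$ are $\sigma$-finite measures on $(X,\mathcal{B}X)$ and $(Y,\mathcal{B}Y)$. The prior $\mu_{\mathrm{prior}}\in\mathrm{Prob}(X)$ satisfies $\mu_{\mathrm{prior}}\ll\nu_X$ with density $\pi_{\mathrm{prior}}$. The likelihood $L(y^\dagger|\theta')\ge 0$ is defined for every $y^\dagger\in Y$ and $\mu_{\mathrm{prior}}$-a.e. $\theta'\in X$; $L(\cdot|\theta')$ is the $\nu_Y$-density of the conditional distribution of the data $y$ given $\theta=\theta'$, and $L(y^\dagger|\cdot)$ is measurable. Put $Z(y^\dagger):=\int_X L(y^\dagger|\theta)\,\mathrm{d}\mu_{\mathrm{prior}}(\theta)$. Bayesian inverse problem: for data $y^\dagger\in Y$, find the posterior $\mu_{\mathrm{post}}^\dagger\in\mathrm{Prob}(X,\mu_{\mathrm{prior}})$ with $\nu_X$-density $\theta\mapsto L(y^\dagger|\theta)\pi_{\mathrm{prior}}(\theta)/Z(y^\dagger)$. The posterior for data $y^\ddagger$ is denoted $\mu_{\mathrm{post}}^\ddagger$. Kullback--Leibler divergence: for $\mu\in\mathrm{Prob}(X)$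 and $\mu'\in\mathrm{Prob}(X,\mu)$, if defined, $\mathrm{D}_{\mathrm{KL}}(\mu'\|\mu):=\int_X\log\left(\frac{\mathrm{d}\mu'}{\mathrm{d}\mu}\right)\mathrm{d}\mu'$. Kullback--Leibler well-posedness: (1) for every $y^\dagger\in Y$, $\mu_{\mathrm{post}}^\dagger\in\mathrm{Prob}(X,\mu_{\mathrm{prior}})$ exists; (2) it is unique in $\mathrm{Prob}(X,\mu_{\mathrm{prior}})$; and (3) for all $y^\dagger\in Y$ and $\varepsilon>0$ there is $\delta(\varepsilon)>0$ such that $\mathrm{D}_{\mathrm{KL}}(\mu_{\mathrm{post}}^\dagger\|\mu_{\mathrm{post}}^\ddagger)\le\varepsilon$ for all $y^\ddagger\in Y$ with $\|y^\dagger-y^\ddagger\|_Y\le\delta(\varepsilon)$. *)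

(* Defs.v *)
From HB Require Import structures.
From mathcomp Require Import all_boot all_order all_algebra.
From mathcomp Require Import all_classical all_reals all_analysis.
Import Order.TTheory GRing.Theory Num.Theory.
Import numFieldNormedType.Exports.

Set Implicit Arguments.
Unset Strict Implicit.
Unset Printing Implicit Defensive.

Local Open Scope classical_set_scope.
Local Open Scope ring_scope.
Local Open Scope charge_scope.

Definition separable (T : topologicalType) : Prop :=
  exists2 D : set T, countable D & dense D.

Definition completely_metrisable (R : realType) (T : topologicalType) : Prop :=
  exists d : T -> T -> R,
    [/\ [/\ forall x y, 0 <= d x y,
            forall x y, d x y = 0 <-> x = y,
            forall x y, d x y = d y x &
            forall x y z, d x z <= d x y + d y z],
        forall (x : T) (A : set T),
          nbhs x A <-> exists2 e : R, 0 < e & [set y | d x y < e] `<=` A &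
        forall u : nat -> T,
          (forall e : R, 0 < e ->
             exists N : nat, forall m n, (N <= m)%N -> (N <= n)%N ->
               d (u m) (u n) < e) ->
          exists l : T, u @ \oo --> l].

Notation borel T := (g_sigma_algebraType (@open T)).

Notation borel_measurable := (<<s @open _ >>) (only parsing).

(* [X] with the subspace topology. The library's measurable types are pointed,
   hence the nonemptiness proof; a set carrying a probability measure is
   nonempty anyway. *)
Definition subspace_type (T : topologicalType) (X : set T) (hX : X !=set0) :
  Type := set_type X.

Section SubspaceInstances.
Variables (T : topologicalType) (X : set T) (hX : X !=set0).

HB.instance Definition _ := Topological.copy (subspace_type hX) (set_type X).
HB.instance Definition _ := isPointed.Build (subspace_type hX)
  (SigSub (mem_set (projT2 (cid hX))) : subspace_type hX).

End SubspaceInstances.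

Section Bayes.
Context (R : realType) (d : measure_display) (T : measurableType d).

Definition L1 (mu : set T -> \bar R) (f : T -> R) : Prop :=
  mu.-integrable setT (EFin \o f).

Definition is_density (nu : {measure set T -> \bar R})
    (mu : set T -> \bar R) (f : T -> R) : Prop :=
  [/\ measurable_fun setT f,
      {ae nu, forall x, 0 <= f x} &
      forall A, measurable A -> mu A = (\int[nu]_(x in A) (f x)%:E)%E].

Definition strictly_positive_pdf (nu : {measure set T -> \bar R})
    (f : T -> R) : Prop :=
  [/\ measurable_fun setT f,
      forall x, 0 < f x &
      (\int[nu]_x (f x)%:E = 1)%E].

(* The integrand of the Kullback-Leibler divergence, [log (d mu' / d mu)]. *)
Definition log_RN (mu' mu : probability T R) (x : T) : \bar R :=
  lne ('d (charge_of_finite_measure mu') '/d mu x)%E.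

(* [D_KL (mu' || mu)] makes sense: [mu'] has a density with respect to [mu] and
   the integral below exists, possibly with an infinite value. (The library
   gives a value to every integral, even when both parts are infinite.) *)
Definition KL_defined (mu' mu : probability T R) : Prop :=
  mu' `<< mu /\
  ((\int[mu']_x (log_RN mu' mu)^\+ x)%E
     +? (- \int[mu']_x (log_RN mu' mu)^\- x)%E)%E.

Definition KL (mu' mu : probability T R) : \bar R :=
  (\int[mu']_x log_RN mu' mu x)%E.

End Bayes.

Section BayesianInverseProblem.
Context (R : realType) (d : measure_display) (X : measurableType d)
  (Y : completeNormedModType R).

(* [L y th] stands for L(y|th); [K th] is the conditional distribution of the
   data given that the parameter equals [th]. The likelihood is only meaningful
   for almost every [th]: [L] is a total function, measurable in [th],
   whose values on a null set of parameters are arbitrary. *)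
Definition is_likelihood (prior : probability X R)
    (nuY : {measure set (borel Y) -> \bar R}) (K : R.-pker X ~> borel Y)
    (L : Y -> X -> R) : Prop :=
  [/\ forall y, measurable_fun setT (L y),
      {ae prior, forall th, forall y, 0 <= L y th} &
      {ae prior, forall th,
        is_density nuY (K th) (fun y : borel Y => L y th)}].

Definition evidence (prior : probability X R) (L : Y -> X -> R) (y : Y) : R :=
  \int[prior]_th L y th.

(* If the evidence is 0 or infinite, the candidate density is identically 0 by
   the conventions on division and on [Rintegral], and no measure is a
   posterior. *)
Definition is_posterior (nuX : {measure set X -> \bar R})
    (prior : probability X R) (pi_prior : X -> R) (L : Y -> X -> R)
    (y : Y) (post : probability X R) : Prop :=
  post `<< prior /\
  is_density nuX post (fun th => L y th * pi_prior th / evidence prior L y).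

(* Uniqueness is equality on measurable sets: a library measure is a function
   on all sets, whose values elsewhere are irrelevant. *)
Definition KL_well_posed (nuX : {measure set X -> \bar R})
    (prior : probability X R) (pi_prior : X -> R) (L : Y -> X -> R) : Prop :=
  let posterior := is_posterior nuX prior pi_prior L in
  [/\ forall y, exists post, posterior y post,
      forall y post post', posterior y post -> posterior y post' ->
        forall A, measurable A -> post A = post' A &
      forall (y : Y) (eps : R), 0 < eps ->
        exists2 delta : R, 0 < delta &
          forall (y' : Y) (post post' : probability X R),
            `|y - y'| <= delta ->
            posterior y post -> posterior y' post' ->
            KL_defined post post' /\ (KL post post' <= eps%:E)%E].

End BayesianInverseProblem.

(* Main.v *)
Require Import Defs.
From HB Require Import structures.
From mathcomp Require Import all_boot all_order all_algebra.
From mathcomp Require Import all_classical all_reals all_analysis.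
From mathcomp Require Import measurable_realfun.
From mathcomp Require Import ring.
Import Order.TTheory GRing.Theory Num.Theory.
Import numFieldNormedType.Exports.

(** The likelihood is almost surely positive and integrable, so the evidence
    [Z y] is a positive real number. Multiplying the [nuX]-density of the prior
    by [L y / Z y] amounts to integrating [L y / Z y] against the prior
    ([integral_density]), so a posterior for [y] is the same thing as a
    probability whose density with respect to the prior is [L y / Z y]
    ([is_posteriorP]). Existence and uniqueness follow at once.

    Two posteriors, for [y] and [y'], have densities with respect to the prior
    whose quotient is [expR (log_density_ratio y y')]; this is therefore the
    Radon-Nikodym derivative of one with respect to the other
    ([Radon_Nikodym_of_densities]). Hence the divergence is the integral of

      [ln (L y) - ln (L y') + (ln (Z y') - ln (Z y))]

    against the posterior for [y] ([posterior_KL]).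

    Let [y'] run through a sequence converging to [y]. The bound [g] and
    dominated convergence for the prior give [Z y' --> Z y]; the bound [2 * h] on
    the logarithm of the likelihood ratio and dominated convergence for the
    posterior show that the rest of the integral vanishes in the limit. The
    sequential statement is turned into a radius [delta] by
    [ball_of_sequences]. *)

Set Implicit Arguments.
Unset Strict Implicit.
Unset Printing Implicit Defensive.

Local Open Scope classical_set_scope.
Local Open Scope ring_scope.
Local Open Scope charge_scope.

(** * Densities of measures *)

Section Densities.
Context (R : realType) (d : measure_display) (T : measurableType d).

Lemma null_dominates_ae (nu mu : {measure set T -> \bar R}) (Q : T -> Prop) :
  nu `<< mu -> {ae mu, forall x, Q x} -> {ae nu, forall x, Q x}.
Proof.
move=> /null_content_dominatesP numu [N [mN N0 QN]].
by exists N; split => //; exact: numu.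
Qed.

(** A density vanishes almost everywhere on every null set of its measure. *)
Lemma density_null_ae0 (nu : {measure set T -> \bar R}) (mu : set T -> \bar R)
    (f : T -> R) (N : set T) :
  is_density nu mu f -> measurable N -> mu N = 0%E ->
  {ae nu, forall x, N x -> f x = 0}.
Proof.
move=> [mf f0 muE] mN muN0.
have mfN : measurable_fun N (EFin \o f : T -> \bar R).
  exact/measurable_EFinP/measurable_funTS.
have : (\int[nu]_(x in N) `|(EFin \o f) x| = 0)%E.
  rewrite -muN0 muE//; apply: ae_eq_integral => //.
    exact: measurableT_comp.
  by apply: filterS f0 => x fx0 _; rewrite gee0_abs// lee_fin.
move=> /(ae_eq_integral_abs _ mN mfN); apply: filterS => x /[apply] fx0.
by apply: EFin_inj.
Qed.

(** [p] is the density of [mu] with respect to [nu], and [f] is nonnegative only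
    [mu]-almost everywhere: where [f] may be negative, [p] vanishes
    [nu]-almost everywhere. *)
Section transfer.
Variables (nu : {sigma_finite_measure set T -> \bar R})
  (mu : {finite_measure set T -> \bar R}) (p f : T -> R).
Hypotheses (numu : mu `<< nu) (dp : is_density nu mu p).
Hypotheses (mf : measurable_fun setT f) (f0 : {ae mu, forall x, 0 <= f x}).

Lemma density_mul_ge0 : {ae nu, forall x, 0 <= f x * p x}.
Proof.
have [N [mN N0 fN]] := f0.
have [_ p0 _] := dp.
apply: filterS2 p0 (density_null_ae0 dp mN N0) => x px0 pN.
have [Nx|Nx] := pselect (N x); first by rewrite pN// mulr0.
apply: mulr_ge0 => //; apply: contrapT => fx; exact/Nx/fN.
Qed.

Lemma integral_density (A : set T) : measurable A ->
  (\int[mu]_(x in A) (f x)%:E = \int[nu]_(x in A) (f x * p x)%:E)%E.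
Proof.
move=> mA; pose f' x := Num.max (f x) 0.
have mf' : measurable_fun setT f' by exact: measurable_maxr.
have [mp p0 muE] := dp.
pose q := Radon_Nikodym_SigmaFinite.f mu nu.
have iq : nu.-integrable setT q.
  exact: Radon_Nikodym_SigmaFinite.f_integrable.
have mq : measurable_fun setT q by exact: measurable_int iq.
(* The Radon-Nikodym derivative [q] is almost everywhere the given density. *)
have qp : ae_eq nu setT q (EFin \o p).
  apply: integral_ae_eq => //; first exact/measurable_EFinP.
  by move=> E _ mE; rewrite -Radon_Nikodym_SigmaFinite.f_integral// muE.
(* The change of variables below needs a function that is nonnegative
   everywhere, hence the passage to the positive part. *)
transitivity (\int[mu]_(x in A) (f' x)%:E)%E.
  apply: ae_eq_integral => //; [exact/measurable_EFinP/measurable_funTS..|].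
  by apply: filterS f0 => x fx0 _; rewrite /f' max_l.
rewrite -(Radon_Nikodym_SigmaFinite.change_of_variables numu)//; last 2 first.
- by move=> x; rewrite lee_fin le_max lexx orbT.
- exact/measurable_EFinP/measurable_funTS.
apply: ae_eq_integral => //.
- apply: emeasurable_funM; last exact: measurable_funTS.
  exact/measurable_EFinP/measurable_funTS.
- exact/measurable_EFinP/measurable_funTS/measurable_funM.
have [N [mN N0 fN]] := f0.
apply: filterS2 qp (density_null_ae0 dp mN N0) => x qpx pN _.
rewrite -/q qpx//= -EFinM; congr (_%:E).
have [Nx|Nx] := pselect (N x); first by rewrite pN// !mulr0.
rewrite /f' max_l//; apply: contrapT => fx; exact/Nx/fN.
Qed.

End transfer.

Section density_probability.
Variables (mu : {measure set T -> \bar R}) (f : T -> R).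
Hypotheses (mf : measurable_fun setT f) (f0 : forall x, 0 <= f x).
Hypothesis f1 : (\int[mu]_x (f x)%:E = 1)%E.

(** The probability with density [f] with respect to [mu]. The hypotheses on [f]
    are arguments so that the probability structure can be attached to it. *)
Definition density_probability of (measurable_fun setT f) & (forall x, 0 <= f x)
  & (\int[mu]_x (f x)%:E = 1)%E :=
  fun A : set T => (\int[mu]_(x in A) (f x)%:E)%E.

Local Notation P := (density_probability mf f0 f1).

Let P0 : P set0 = 0%E.
Proof. exact: integral_set0. Qed.

Let P_ge0 A : (0 <= P A)%E.
Proof. by apply: integral_ge0 => x _; rewrite lee_fin. Qed.

Let P_sigma_additive : semi_sigma_additive P.
Proof.
by apply: semi_sigma_additive_nng_induced => //; exact/measurable_EFinP.
Qed.

HB.instance Definition _ := isMeasure.Build _ _ _ P P0 P_ge0 P_sigma_additive.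

Let P1 : P setT = 1%E. Proof. exact: f1. Qed.

HB.instance Definition _ := Measure_isProbability.Build _ _ R P P1.

End density_probability.

Lemma density_exists (mu : {measure set T -> \bar R}) (f : T -> R) :
  measurable_fun setT f -> {ae mu, forall x, 0 <= f x} ->
  (\int[mu]_x (f x)%:E = 1)%E ->
  exists P : probability T R, is_density mu P f.
Proof.
move=> mf f0 f1; pose g x := Num.max (f x) 0.
have mg : measurable_fun setT g by exact: measurable_maxr.
have g0 x : 0 <= g x by rewrite le_max lexx orbT.
have gE A : measurable A ->
    (\int[mu]_(x in A) (g x)%:E = \int[mu]_(x in A) (f x)%:E)%E.
  move=> mA; apply: ae_eq_integral => //;
    [exact/measurable_EFinP/measurable_funTS..|].
  by apply: filterS f0 => x fx0 _; rewrite /g max_l.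
have g1 : (\int[mu]_x (g x)%:E = 1)%E by rewrite gE.
by exists (density_probability mg g0 g1); split => // A mA; exact: gE.
Qed.

Lemma density_dominates (mu : {measure set T -> \bar R}) (nu : set T -> \bar R)
    (f : T -> R) : is_density mu nu f -> nu `<< mu.
Proof.
move=> [mf _ nuE]; apply/null_content_dominatesP => A mA A0.
rewrite nuE// null_set_integral//; exact/measurable_EFinP/measurable_funTS.
Qed.

Lemma positive_density_dominates (mu : {measure set T -> \bar R})
    (nu : {measure set T -> \bar R}) (f : T -> R) :
  is_density mu nu f -> {ae mu, forall x, 0 < f x} -> mu `<< nu.
Proof.
move=> df f0; apply/null_content_dominatesP => A mA A0.
apply/(negligibleP _ mA).
have := density_null_ae0 df mA A0.
have : mu.-negligible (~` [set x | ~ A x]) -> mu.-negligible A by rewrite setCK.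
move=> + fA; apply; apply: filterS2 f0 fA => x fx fA Ax.
by move: fx; rewrite fA// ltxx.
Qed.

End Densities.

(** * The Kullback-Leibler divergence of two densities *)

(** [mu] and [mu'] have densities [f] and [f'] with respect to [P], and [g] is the
    logarithm of [f / f']; the exponential form of that relation avoids a
    quotient. *)
Section KullbackLeibler.
Context (R : realType) (d : measure_display) (T : measurableType d).
Variables (P mu mu' : probability T R) (f f' g : T -> R).
Hypotheses (df : is_density P mu f) (df' : is_density P mu' f').
Hypotheses (f'0 : {ae P, forall x, 0 < f' x}).
Hypotheses (mg : measurable_fun setT g)
  (fg : {ae P, forall x, f x = expR (g x) * f' x}).

Lemma dominates_of_densities : mu `<< mu'.
Proof.
apply: null_dominates_trans (density_dominates df) _.
exact: positive_density_dominates df' f'0.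
Qed.

Lemma Radon_Nikodym_of_densities :
  {ae mu', forall x,
    ('d (charge_of_finite_measure mu) '/d mu' x = (expR (g x))%:E)%E}.
Proof.
have numu := dominates_of_densities.
have meg : measurable_fun setT (expR \o g) by exact: measurableT_comp.
have : ae_eq mu' setT ('d (charge_of_finite_measure mu) '/d mu')
    (EFin \o (expR \o g)).
  apply: integral_ae_eq => //.
  - exact: Radon_Nikodym_integrable.
  - exact/measurable_EFinP.
  - move=> E _ mE; rewrite -Radon_Nikodym_integral//=.
    rewrite (integral_density (density_dominates df') df')//; last first.
      by apply: aeW => x; exact: expR_ge0.
    have [mf _ muE] := df; have [mf' _ _] := df'.
    rewrite [LHS]muE//; apply: ae_eq_integral => //.
    + exact/measurable_EFinP/measurable_funTS.
    + exact/measurable_EFinP/measurable_funTS/measurable_funM.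
    + by apply: filterS fg => x -> _.
by apply: filterS => x ->.
Qed.

(** The function [lne] is [-oo] on the nonpositive numbers, and the Radon-Nikodym
    derivative is everywhere finite. *)
Lemma measurable_log_RN : measurable_fun setT (log_RN mu mu').
Proof.
have numu := dominates_of_densities.
set D := 'd (charge_of_finite_measure mu) '/d mu'.
have mD : measurable_fun setT (fine \o D).
  apply: measurableT_comp => //; apply: (measurable_int mu').
  exact: Radon_Nikodym_integrable.
have -> : log_RN mu mu' =
    fun x => if fine (D x) <= 0 then -oo%E else (ln (fine (D x)))%:E.
  apply/funext => x; rewrite /log_RN -/D.
  by rewrite -{1}(@fineK _ (D x))//; exact: Radon_Nikodym_fin_num.
apply: measurable_fun_ifT => //.
- exact: measurable_fun_ler.
- by apply/measurable_EFinP; exact: measurableT_comp.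
Qed.

Lemma log_RN_of_densities : {ae mu, forall x, log_RN mu mu' x = (g x)%:E}.
Proof.
apply: null_dominates_ae dominates_of_densities _.
apply: filterS Radon_Nikodym_of_densities => x.
by rewrite /log_RN => ->; rewrite lne_EFin ?expR_gt0// expRK.
Qed.

Hypothesis ig : L1 mu g.

Lemma KL_defined_of_densities : KL_defined mu mu'.
Proof.
split; first exact: dominates_of_densities.
have il : mu.-integrable setT (log_RN mu mu').
  have [_ g_lty] := integrableP _ _ _ ig.
  apply/integrableP; split; first exact: measurable_log_RN.
  rewrite (ae_eq_integral (abse \o (EFin \o g)))//.
  - by apply: measurableT_comp => //; exact: measurable_log_RN.
  - by apply: measurableT_comp => //; exact/measurable_EFinP.
  - by apply: filterS log_RN_of_densities => x /= -> _.
by apply: fin_num_adde_defr; apply: integrable_fin_num => //;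
  exact: integrable_funepos.
Qed.

Lemma KL_of_densities : KL mu mu' = (\int[mu]_x (g x)%:E)%E.
Proof.
apply: ae_eq_integral => //; first exact: measurable_log_RN.
  exact/measurable_EFinP.
by apply: filterS log_RN_of_densities => x -> _.
Qed.

End KullbackLeibler.

(** * From sequences to balls *)

(** A property that holds at some term of every sequence converging to [y] within
    the closed ball of radius [r] holds throughout some smaller ball. *)
Lemma ball_of_sequences (R : realType) (Y : normedModType R) (y : Y) (r : R)
    (Q : Y -> Prop) : 0 < r ->
  (forall u : nat -> Y, (forall n, `|y - u n| <= r) -> u @ \oo --> y ->
    exists n, Q (u n)) ->
  exists2 delta : R, 0 < delta <= r & forall y', `|y - y'| <= delta -> Q y'.
Proof.
move=> r0 Qu; apply: contrapT => noball.
(* If no ball works, [Q] fails at some point within each distance [e n] of [y];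
   these points form a sequence that converges to [y]. *)
pose e n : R := Num.min r n.+1%:R^-1.
have e0 n : 0 < e n by rewrite lt_min r0 invr_gt0 ltr0n.
have /choice[u uP] n : exists y' : Y, `|y - y'| <= e n /\ ~ Q y'.
  apply: contrapT => nobad; apply: noball.
  exists (e n); first by rewrite e0 ge_min lexx.
  by move=> y' yy'; apply: contrapT => Qy'; apply: nobad; exists y'.
have [n|| n Qn] := Qu u.
- by have [+ _] := uP n; rewrite le_min => /andP[].
- apply/cvgrPdist_lt => eps eps0; near=> n.
  have [+ _] := uP n; rewrite le_min => /andP[_ /le_lt_trans]; apply.
  by near: n; exact: (near_infty_natSinv_lt (PosNum eps0)).
- by have [] := uP n.
Unshelve. all: by end_near. Qed.

(** * Posteriors as densities with respect to the prior *)

Section Bayes.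
Context (R : realType) (d : measure_display) (X : measurableType d)
  (Y : completeNormedModType R).
Variables (nuX : {sigma_finite_measure set X -> \bar R})
  (prior : probability X R) (pi_prior : X -> R) (L : Y -> X -> R).
Hypotheses (prior_nuX : prior `<< nuX)
  (prior_density : is_density nuX prior pi_prior).
Hypotheses (mL : forall y, measurable_fun setT (L y))
  (L_gt0 : {ae prior, forall th, forall y, 0 < L y th})
  (iL : forall y, L1 prior (L y)).

Local Notation Z := (evidence prior L).

Lemma evidenceE y : (\int[prior]_th (L y th)%:E = (Z y)%:E)%E.
Proof. by rewrite fineK//; apply: integrable_fin_num => //; exact: iL. Qed.

Lemma evidence_gt0 y : 0 < Z y.
Proof.
have mLy : measurable_fun setT (EFin \o L y) by exact/measurable_EFinP.
have ZE : ((Z y)%:E = \int[prior]_th `|(L y th)%:E|)%E.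
  rewrite -evidenceE; apply: ae_eq_integral => //.
    exact: measurableT_comp.
  by apply: filterS L_gt0 => th L0 _; rewrite gee0_abs// lee_fin ltW.
have Z0 : 0 <= Z y by rewrite -lee_fin ZE; exact: integral_ge0.
rewrite lt_neqAle Z0 andbT; apply/eqP => Zy0.
have : (\int[prior]_th `|(EFin \o L y) th| = 0)%E by rewrite -ZE -Zy0.
move=> /(ae_eq_integral_abs _ measurableT mLy) L0.
have prior_proper : ProperFilter (almost_everywhere prior).
  apply: ae_properfilter_algebraOfSetsType.
  by rewrite [X in (_ < X)%E]probability_setT lte01.
have [th [/(_ I)/= Lth0 /(_ y)]] := filter_ex (filterI L0 L_gt0).
by case: Lth0 => ->; rewrite ltxx.
Qed.

Lemma measurable_posterior_density y :
  measurable_fun setT (fun th => L y th / Z y).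
Proof. by apply: measurable_funM => //; exact: measurable_cst. Qed.

Lemma posterior_density_gt0 y : {ae prior, forall th, 0 < L y th / Z y}.
Proof.
by apply: filterS L_gt0 => th L0; rewrite divr_gt0// evidence_gt0.
Qed.

(** The density with respect to [nuX] in the definition of a posterior can be
    traded for a density with respect to the prior. *)
Lemma is_posteriorP y (post : probability X R) :
  is_posterior nuX prior pi_prior L y post <->
  is_density prior post (fun th => L y th / Z y).
Proof.
have mf := measurable_posterior_density y.
have f0 : {ae prior, forall th, 0 <= L y th / Z y}.
  by apply: filterS (posterior_density_gt0 y) => th /ltW.
have LpiE th : L y th * pi_prior th / Z y = L y th / Z y * pi_prior th.
  by rewrite mulrAC.
have intE A : measurable A -> (\int[prior]_(th in A) (L y th / Z y)%:E =
    \int[nuX]_(th in A) (L y th * pi_prior th / Z y)%:E)%E.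
  move=> mA; rewrite (integral_density prior_nuX prior_density)//.
  by apply: eq_integral => th _; rewrite LpiE.
split=> [[_ [_ _ postE]]|dpost].
  by split => // A mA; rewrite postE// intE.
split; first exact: density_dominates dpost.
have [mpi _ _] := prior_density.
split.
- under eq_fun do rewrite LpiE.
  exact: measurable_funM.
- by apply: filterS (density_mul_ge0 prior_density f0) => th; rewrite LpiE.
- by move=> A mA; have [_ _ postE] := dpost; rewrite postE// intE.
Qed.

Lemma posterior_exists y :
  exists post, is_posterior nuX prior pi_prior L y post.
Proof.
have f0 : {ae prior, forall th, 0 <= L y th / Z y}.
  by apply: filterS (posterior_density_gt0 y) => th /ltW.
have [|post dpost] := density_exists (measurable_posterior_density y) f0.
  under eq_integral do rewrite mulrC EFinM.
  rewrite integralZl//; last exact: iL.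
  by rewrite evidenceE -EFinM mulVf// gt_eqF// evidence_gt0.
by exists post; exact/is_posteriorP.
Qed.

Lemma posterior_unique y (post post' : probability X R) :
  is_posterior nuX prior pi_prior L y post ->
  is_posterior nuX prior pi_prior L y post' ->
  forall A, measurable A -> post A = post' A.
Proof.
by move=> [_ [_ _ postE]] [_ [_ _ post'E]] A mA; rewrite postE// post'E.
Qed.

(** * The divergence between posteriors *)

(** The logarithm of the quotient of the posterior densities for [y] and [y']. *)
Definition log_density_ratio (y y' : Y) (th : X) : R :=
  (ln (L y th) - ln (L y' th)) + (ln (Z y') - ln (Z y)).

Lemma measurable_log_likelihood_ratio y y' :
  measurable_fun setT (fun th => ln (L y th) - ln (L y' th)).
Proof. by apply: measurable_funB; exact: measurableT_comp. Qed.

Lemma measurable_log_density_ratio y y' :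
  measurable_fun setT (log_density_ratio y y').
Proof.
apply: measurable_funD; last exact: measurable_cst.
exact: measurable_log_likelihood_ratio.
Qed.

Lemma expR_log_density_ratio y y' : {ae prior, forall th,
  L y th / Z y = expR (log_density_ratio y y' th) * (L y' th / Z y')}.
Proof.
apply: filterS L_gt0 => th L0.
have Zy := evidence_gt0 y; have Zy' := evidence_gt0 y'.
rewrite /log_density_ratio expRD !expRD !expRN !lnK ?posrE//.
by field; rewrite !gt_eqF ?L0.
Qed.

(** [g] dominates the likelihood, [h] dominates its logarithm for data within
    distance [r] of [y], and [post] is any probability that is absolutely
    continuous with respect to the prior and integrates [h]. *)
Section Stability.
Variables (g : X -> R) (ig : L1 prior g)
  (Lg : {ae prior, forall th, forall y, L y th <= g th})
  (Lc : {ae prior, forall th, continuous (L ^~ th)}).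

Lemma evidence_cvg (y : Y) (u : nat -> Y) : u @ \oo --> y ->
  Z (u n) @[n --> \oo] --> Z y.
Proof.
move=> uy; apply: fine_cvg; rewrite -evidenceE.
have [//|||||_ _] := @dominated_convergence _ _ _ prior setT measurableT
  (fun n th => (L (u n) th)%:E) (fun th => (L y th)%:E) (EFin \o g).
- by move=> n; exact/measurable_EFinP.
- exact/measurable_EFinP.
- apply: filterS Lc => th Lth _; apply: cvg_EFin; first exact: nearW.
  exact: (cvg_comp _ _ uy (Lth y)).
- exact: ig.
- apply: filterS2 Lg L_gt0 => th Lth L0 n _ /=.
  by rewrite ger0_norm ?lee_fin// ltW.
- by [].
Qed.

Variables (y : Y) (r : R) (h : X -> R) (post : probability X R).
Hypotheses (r0 : 0 <= r) (post_dom : post `<< prior) (ih : L1 post h)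
  (hP : {ae prior, forall th, forall y',
    `|y - y'| <= r -> `|ln (L y' th)| <= h th}).

Lemma log_likelihood_ratio_bound : {ae post, forall th, forall y',
  `|y - y'| <= r -> `|ln (L y th) - ln (L y' th)| <= 2 * h th}.
Proof.
apply: null_dominates_ae post_dom _.
apply: filterS hP => th hth y' yy'.
rewrite (le_trans (ler_normB _ _))// mulr_natl mulr2n lerD ?hth//.
by rewrite subrr normr0.
Qed.

Lemma L1_double_bound : L1 post (fun th => 2 * h th).
Proof. exact: (integrableZl measurableT 2 ih). Qed.

Lemma log_likelihood_ratio_integral_cvg (u : nat -> Y) :
  (forall n, `|y - u n| <= r) -> u @ \oo --> y ->
  (\int[post]_th (ln (L y th) - ln (L (u n) th))%:E)%E @[n --> \oo] --> 0%E.
Proof.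
move=> ur uy.
have [//|||||_ _] := @dominated_convergence _ _ _ post setT measurableT
  (fun n th => (ln (L y th) - ln (L (u n) th))%:E) (cst 0%E)
  (fun th => (2 * h th)%:E).
- by move=> n; apply/measurable_EFinP; exact: measurable_log_likelihood_ratio.
- exact: measurable_cst.
- apply: null_dominates_ae post_dom _.
  apply: filterS2 Lc L_gt0 => th Lth L0 _; apply: cvg_EFin; first exact: nearW.
  rewrite -[X in _ --> X](subrr (ln (L y th))).
  apply: cvgB; first exact: cvg_cst.
  apply: continuous_cvg; first exact: continuous_ln.
  exact: (cvg_comp _ _ uy (Lth y)).
- exact: L1_double_bound.
- apply: filterS log_likelihood_ratio_bound => th hth n _ /=.
  by rewrite lee_fin hth.
- by rewrite integral0.
Qed.

Lemma L1_log_likelihood_ratio y' : `|y - y'| <= r ->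
  L1 post (fun th => ln (L y th) - ln (L y' th)).
Proof.
move=> yy'.
have m := measurable_log_likelihood_ratio y y'.
have [mh h_lty] := integrableP _ _ _ L1_double_bound.
apply/integrableP; split; first exact/measurable_EFinP.
apply: le_lt_trans h_lty; apply: ae_ge0_le_integral => //.
- by apply: measurableT_comp => //; exact/measurable_EFinP.
- exact: measurableT_comp.
- apply: filterS log_likelihood_ratio_bound => th hth _ /=.
  by rewrite lee_fin (le_trans (hth _ yy'))// ler_norm.
Qed.

Lemma L1_log_density_ratio y' : `|y - y'| <= r ->
  L1 post (log_density_ratio y y').
Proof.
move=> yy'.
have ic : L1 post (cst (ln (Z y') - ln (Z y))).
  exact: finite_measure_integrable_cst.
exact: (integrableD measurableT (L1_log_likelihood_ratio yy') ic).
Qed.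

Lemma integral_log_density_ratio y' : `|y - y'| <= r ->
  (\int[post]_th (log_density_ratio y y' th)%:E =
   \int[post]_th (ln (L y th) - ln (L y' th))%:E + (ln (Z y') - ln (Z y))%:E)%E.
Proof.
move=> yy'; under eq_integral do rewrite EFinD.
rewrite integralD//; last 2 first.
- exact: L1_log_likelihood_ratio.
- exact: finite_measure_integrable_cst.
by rewrite integral_cst// [X in (_ * X)%E]probability_setT mule1.
Qed.

Lemma integral_log_density_ratio_cvg (u : nat -> Y) :
  (forall n, `|y - u n| <= r) -> u @ \oo --> y ->
  (\int[post]_th (log_density_ratio y (u n) th)%:E)%E @[n --> \oo] --> 0%E.
Proof.
move=> ur uy.
have c_cvg : (ln (Z (u n)) - ln (Z y))%:E @[n --> \oo] --> 0%E.
  apply: cvg_EFin; first exact: nearW.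
  rewrite -[X in _ --> X](subrr (ln (Z y))); apply: cvgB; last exact: cvg_cst.
  apply: continuous_cvg; last exact: evidence_cvg.
  exact/continuous_ln/evidence_gt0.
have := cvgeD _ (log_likelihood_ratio_integral_cvg ur uy) c_cvg.
rewrite adde0 => /(_ _ isT).
by under eq_fun do rewrite -integral_log_density_ratio//.
Qed.

End Stability.

Lemma posterior_KL (y y' : Y) (post post' : probability X R) :
  is_posterior nuX prior pi_prior L y post ->
  is_posterior nuX prior pi_prior L y' post' ->
  L1 post (log_density_ratio y y') ->
  KL_defined post post' /\
  KL post post' = (\int[post]_th (log_density_ratio y y' th)%:E)%E.
Proof.
move=> /is_posteriorP dpost /is_posteriorP dpost' il.
have m := measurable_log_density_ratio y y'.
have ratio := expR_log_density_ratio y y'.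
have f0 := posterior_density_gt0 y'.
split; first exact: KL_defined_of_densities dpost dpost' f0 m ratio il.
exact: KL_of_densities dpost dpost' f0 m ratio.
Qed.

(** Well-posedness for a parameter space that is any measurable space, with the
    likelihood positive almost everywhere. *)
Lemma KL_well_posed_of_dominated (g : X -> R) : L1 prior g ->
  {ae prior, forall th, forall y, L y th <= g th} ->
  {ae prior, forall th, continuous (L ^~ th)} ->
  (forall y : Y, exists (r : R) (h : X -> R),
    [/\ 0 < r,
      forall post, is_posterior nuX prior pi_prior L y post -> L1 post h &
      {ae prior, forall th, forall y',
        `|y - y'| <= r -> `|ln (L y' th)| <= h th}]) ->
  KL_well_posed nuX prior pi_prior L.
Proof.
move=> ig Lg Lc logL; split; [exact: posterior_exists|exact: posterior_unique|].
move=> y eps eps0; have [r [h [r0 ih hP]]] := logL y.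
(* [delta] may not depend on the posterior for [y], so it is found for one of
   them; any other agrees with it on measurable sets. *)
have [post0 post0P] := posterior_exists y.
have [u ur uy|delta /andP[delta0 deltar] KL_le] := @ball_of_sequences R Y y r
  (fun y' => \int[post0]_th (log_density_ratio y y' th)%:E <= eps%:E)%E r0.
  have := integral_log_density_ratio_cvg ig Lg Lc (ltW r0) post0P.1
    (ih _ post0P) hP ur uy.
  move=> /fine_cvgP[fin_int /cvgrPdist_le/(_ _ eps0) int_le].
  have [n [fin_n int_n]] := filter_ex (filterI fin_int int_le).
  exists n; rewrite -(fineK fin_n) lee_fin.
  by move: int_n; rewrite sub0r normrN; apply: le_trans; exact: ler_norm.
exists delta => // y' post post' yy' postP post'P.
have il : L1 post (log_density_ratio y y').
  apply: L1_log_density_ratio (ltW r0) postP.1 (ih _ postP) hP _ _.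
  exact: le_trans deltar.
have [KLdef ->] := posterior_KL postP post'P il; split => //.
rewrite (eq_measure_integral post0)//; first exact: KL_le.
by move=> A mA _; exact: (posterior_unique postP post0P).
Qed.

End Bayes.

Theorem theorem4p3 (R : realType)
  (Y : completeNormedModType R) (sepY : separable Y)
  (X' : topologicalLmodType R) (sepX' : separable X')
  (cmX' : completely_metrisable R X')
  (X : set X') (mX : borel_measurable X) (hX : X !=set0)
  (nuX : {sigma_finite_measure set (borel (subspace_type hX)) -> \bar R})
  (nuY : {sigma_finite_measure set (borel Y) -> \bar R})
  (prior : probability (borel (subspace_type hX)) R)
  (pi_prior : subspace_type hX -> R)
  (prior_nuX : prior `<< nuX)
  (prior_density : is_density nuX prior pi_prior)
  (K : R.-pker (borel (subspace_type hX)) ~> (borel Y))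
  (L : Y -> subspace_type hX -> R)
  (likL : is_likelihood prior nuY K L)
  (A1 : {ae prior, forall th,
           strictly_positive_pdf nuY (fun y : borel Y => L y th)})
  (A2 : forall y : Y, L1 prior (L y))
  (A3 : exists2 g : subspace_type hX -> R, L1 prior g &
          {ae prior, forall th, forall y : Y, L y th <= g th})
  (A4 : {ae prior, forall th, continuous (fun y : Y => L y th)})
  (A6 : forall y : Y, exists (delta : R) (h : subspace_type hX -> R),
          [/\ 0 < delta,
              forall post : probability (borel (subspace_type hX)) R,
                is_posterior nuX prior pi_prior L y post -> L1 post h &
              {ae prior, forall th, forall y' : Y,
                 `|y - y'| <= delta -> `|ln (L y' th)| <= h th}]) :
  KL_well_posed nuX prior pi_prior L.
Proof.
have [mL _ _] := likL; have [g ig Lg] := A3.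
have L_gt0 : {ae prior, forall th, forall y, 0 < L y th}.
  have filter_ae := ae_filter_ringOfSetsType prior.
  by apply: filterS A1 => th [_ L0 _].
exact: (KL_well_posed_of_dominated prior_nuX prior_density mL L_gt0 A2 ig Lg
  A4 A6).
Qed.
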